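(* Let $\Gamma$ be the concurrency graph of a regular class of heaps $H(P,\mathcal{C})$. Consider an arbitrary word $$e=e_{i_1}e_{i_2}\cdots e_{i_r}$$ in the generators of $TL(\Gamma)$, and define $w\in W_c$ and $m$ by $e=\delta^m e_w$ in $TL(\Gamma)$. (i) If we omit one generator from the word $e$ to form $$e'=e_{i_1}\cdots\widehat{e_{i_l}}\cdots e_{i_r}$$ (where the hat denotes omission) and write $e'=\delta^{m'}e_{w'}$ for some $w'\in W_c$, then $m'\in\{m-1,m,m+1\}$. (ii) If the word $e$ is of the form $e_x$ for some $x\in W_c$, i.e. $s_{i_1}s_{i_2}\cdots s_{i_r}$ is a reduced expression for an element $x\in W_c$, then $m'=0$ (for $e'$ and $m'$ obtained by omitting one generator from $e$ as in (i)).
   Context: Let $P$ be a set with a symmetric and reflexive relation $\mathcal{C}$ (the concurrency relation). A labelled heap with pieces in $P$ is a triple $(E,\leq,\varepsilon)$, where $(E,\leq)$ is a finite (possibly empty) poset and $\varepsilon:E\to P$ is a map such that: (1) if $a,b\in E$ and $\varepsilon(a)\,\mathcal{C}\,\varepsilon(b)$, then $a$ and $b$ are comparable in $\leq$; (2) $\leq$ is the transitive closure of the relation $\leq_{\mathcal{C}}$ defined by $a\leq_{\mathcal{C}}b$ iff $a\leq b$ and $\varepsilon(a)\,\mathcal{C}\,\varepsilon(b)$. A heap $[E,\leq,\varepsilon]$ is an isomorphism class of labelled heaps (isomorphisms being poset isomorphisms compatible with the labellings); $H(P,\mathcal{C})$ is the set (class) of such heaps. One works with representatives. Minimal and maximal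 vertices are with respect to $\leq$. Subheap: for $F\subseteq E$, the subheap on $F$ is $[F,\leq',\varepsilon|_F]$, where $\leq'$ is the transitive closure of the relation ''$a\leq b$ and $\varepsilon(a)\,\mathcal{C}\,\varepsilon(b)$'' on $F$. For $v\in E$, $E(v)$ is the subheap on $E\setminus\{v\}$. A trivial heap is one whose order relation is trivial (no two distinct elements comparable). Property P1: write $E(a)\prec^+E$ (respectively $E(a)\prec^-E$) if $a$ is a maximal (respectively minimal) vertex of $E$ and there is a maximal (respectively minimal) vertex $b$ of $E(a)$ with $\varepsilon(b)\neq\varepsilon(a)$ such that $b$ is not maximal (respectively minimal) in $E$. Write $E(a)\prec E$ if $E(a)\prec^+E$ or $E(a)\prec^-E$. $E$ has property P1 if there is a (possibly trivial) sequence $E_1\prec E_2\prec\cdots\prec E$ of heaps in $H(P,\mathcal{C})$ with $E_1$ a trivial heap. Property P2: a chain $x_1<\cdots<x_t$ in $E$ is convex if whenever $x_i<y<x_j$ for some $y\in E$, then $y$ is in the chain. $E$ has property P2 if it contains no convex chain of the form $x<y<z$ or $x<z$ with $\varepsilon(x)=\varepsilon(z)$ in either case. $H(P,\mathcal{C})$ is regular if every heap of $H(P,\mathcal{C})$ with property P2 also has property P1. The concurrency graph of $H(P,\mathcal{C})$ is the graph with vertex set $P$ in which $p$ and $q$ are adjacent iff $p\neq q$ and $p\,\mathcal{C}\,q$. For a graph $\Gamma$ with vertex set $S$, the (simply laced) Coxeter group $W=W(\Gamma)$ has generators $s_i$ ($i\in S$) and relations $s_i^2=1$, $s_is_js_i=s_js_is_j$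 if $i,j$ are adjacent, and $s_is_j=s_js_i$ otherwise. An expression $w=s_{i_1}\cdots s_{i_r}$ is reduced if $r$ is minimal for $w$. $w$ is fully commutative if any two reduced expressions for $w$ can be transformed into each other by repeatedly applying commutation relations $s_is_j=s_js_i$ with $i,j$ distinct and non-adjacent. $W_c$ is the set of fully commutative elements. Let $\mathcal{A}=\mathbb{Z}[v,v^{-1}]$ and $\delta=v+v^{-1}$. $TL(\Gamma)$ is the $\mathcal{A}$-algebra with generators $e_i$ ($i\in S$) and relations $e_i^2=\delta e_i$, $e_ie_je_i=e_i$ if $i,j$ are adjacent, and $e_ie_j=e_je_i$ otherwise. For $w\in W_c$ with reduced expression $s_{i_1}\cdots s_{i_r}$, set $e_w=e_{i_1}\cdots e_{i_r}$; this is independent of the reduced expression, and $\{e_w:w\in W_c\}$ is a free $\mathcal{A}$-basis of $TL(\Gamma)$. Every word in the generators $e_i$ equals $\delta^m e_w$ in $TL(\Gamma)$ for a unique $w\in W_c$ and a unique integer $m\geq 0$. *)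

(* Defs.v *)
From HB Require Import structures.
From Stdlib Require Import Relations.
From mathcomp Require Import all_boot all_order all_algebra.
From mathcomp Require Import boolp.
From mathcomp.multinomials Require Import monalg.

Set Implicit Arguments.
Unset Strict Implicit.
Unset Printing Implicit Defensive.

Import GRing.Theory.

(* As [C] and [<=] are reflexive, the reflexive-transitive closure [connect]
   of the relation "a <= b and eps(a) C eps(b)" is its transitive closure. *)
Definition closureC (P : choiceType) (C : rel P) (E : finType) (r : rel E)
    (eps : E -> P) : rel E :=
  connect (fun a b => r a b && C (eps a) (eps b)).

Record lheap (P : choiceType) (C : rel P) := LHeap {
  vertex :> finType;
  hle : rel vertex;
  label : vertex -> P;
  hle_refl : reflexive hle;
  hle_anti : antisymmetric hle;
  hle_trans : transitive hle;
  hle_comparable : forall a b, C (label a) (label b) -> hle a b || hle b a;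
  hle_closure : hle =2 closureC C hle label
}.

Section Heaps.
Variables (P : choiceType) (C : rel P).
Implicit Types E F : lheap C.

Definition hlt E (a b : E) := (a != b) && hle a b.

Definition heap_iso E F : Prop :=
  exists f : E -> F,
    [/\ bijective f, {mono f : a b / hle a b} & forall a, label (f a) = label a].

Section Subheap.
Variables (E : lheap C) (F : {set E}).

Definition sub_vertex : finType := {x : E | x \in F}.
Definition sub_label (x : sub_vertex) : P := label (val x).
Definition sub_hle : rel sub_vertex :=
  closureC C (fun x y => hle (val x) (val y)) sub_label.

Lemma sub_hle_le x y : sub_hle x y -> hle (val x) (val y).
Proof.
move=> /connectP[s]; elim: s x => [|z s IHs] x /=; first by move=> _ ->; exact: hle_refl.
by case/andP=> /andP[xz _] zs ys; exact: hle_trans xz (IHs z zs ys).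
Qed.

Lemma sub_hle_refl : reflexive sub_hle. Proof. by move=> x; exact: connect0. Qed.

Lemma sub_hle_anti : antisymmetric sub_hle.
Proof.
move=> x y /andP[/sub_hle_le xy /sub_hle_le yx].
by apply/val_inj/(@hle_anti _ _ E); rewrite xy.
Qed.

Lemma sub_hle_trans : transitive sub_hle.
Proof. by move=> y x z; exact: connect_trans. Qed.

Lemma sub_hle_edge x y :
  hle (val x) (val y) -> C (sub_label x) (sub_label y) -> sub_hle x y.
Proof. by move=> xy Cxy; apply: connect1; rewrite xy. Qed.

Hypothesis Csym : symmetric C.

Lemma sub_hle_comparable x y :
  C (sub_label x) (sub_label y) -> sub_hle x y || sub_hle y x.
Proof.
move=> Cxy; case/orP: (hle_comparable Cxy) => le_xy.
  by rewrite sub_hle_edge.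
by rewrite orbC sub_hle_edge // Csym.
Qed.

Lemma sub_hle_closure : sub_hle =2 closureC C sub_hle sub_label.
Proof.
move=> x y; apply/idP/idP; apply: connect_sub => {x y} x y /andP[xy Cxy].
  by apply: connect1; rewrite Cxy andbT; exact: sub_hle_edge.
exact: xy.
Qed.

Definition subheap : lheap C :=
  LHeap sub_hle_refl sub_hle_anti sub_hle_trans sub_hle_comparable
        sub_hle_closure.

End Subheap.

Definition maximal E (a : E) : Prop := forall b, hle a b -> b = a.
Definition minimal E (a : E) : Prop := forall b, hle b a -> b = a.

Definition trivial_heap E : Prop := forall a b : E, hle a b -> a = b.

End Heaps.

Arguments maximal {P C} E a.
Arguments minimal {P C} E a.

Section Regularity.
Variables (P : choiceType) (C : rel P) (Csym : symmetric C).
Implicit Types E F : lheap C.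

Definition del E (v : E) : lheap C := subheap [set~ v] Csym.

(* [E] and [F] represent isomorphism classes, hence [heap_iso F (del a)] for
   the equality F = E(a) between heaps. *)
Definition prec_plus F E : Prop :=
  exists a : E,
    [/\ heap_iso F (del a), maximal E a &
        exists b : del a,
          [/\ maximal (del a) b, label b <> label a & ~ maximal E (val b)]].

Definition prec_minus F E : Prop :=
  exists a : E,
    [/\ heap_iso F (del a), minimal E a &
        exists b : del a,
          [/\ minimal (del a) b, label b <> label a & ~ minimal E (val b)]].

Definition prec F E : Prop := prec_plus F E \/ prec_minus F E.

Definition property_P1 E : Prop :=
  exists2 E1, trivial_heap E1 & clos_refl_trans (lheap C) prec E1 E.

Definition convex_chain E (s : seq E) : Prop :=
  sorted (@hlt P C E) s /\
  forall x y z, x \in s -> z \in s -> hlt x y -> hlt y z -> y \in s.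

Definition property_P2 E : Prop :=
  (forall x y z : E, convex_chain [:: x; y; z] -> label x <> label z) /\
  (forall x z : E, convex_chain [:: x; z] -> label x <> label z).

Definition regular : Prop := forall E, property_P2 E -> property_P1 E.

End Regularity.

Definition concurrency_graph (P : choiceType) (C : rel P) : rel P :=
  fun p q => (p != q) && C p q.

Section WordCongruence.
Variables (S : Type) (r : seq S -> seq S -> Prop).

Definition word_step (s t : seq S) : Prop :=
  exists a b u v, [/\ r u v, s = a ++ u ++ b & t = a ++ v ++ b].

(* The least monoid congruence on words that contains [r]. *)
Definition word_cong : seq S -> seq S -> Prop :=
  clos_refl_sym_trans (seq S) word_step.

Lemma word_cong_step u v : r u v -> word_cong u v.
Proof. by move=> ruv; apply: rst_step; exists [::], [::], u, v; rewrite !cats0. Qed.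

Lemma word_congM s t s' t' :
  word_cong s t -> word_cong s' t' -> word_cong (s ++ s') (t ++ t').
Proof.
move=> st st'; apply: (@rst_trans _ _ _ (t ++ s')).
  elim: st => {s t} [s t [a [b [u [v [ruv -> ->]]]]]|s|s t _|s t w _ st _ tw].
  - by apply: rst_step; exists a, (b ++ s'), u, v; rewrite -!catA.
  - exact: rst_refl.
  - exact: rst_sym.
  - exact: rst_trans st tw.
elim: st' => {s' t'} [s' t' [a [b [u [v [ruv -> ->]]]]]|s'|s' t' _|s' t' w _ IH _ tw].
- by apply: rst_step; exists (t ++ a), b, u, v; rewrite -!catA.
- exact: rst_refl.
- exact: rst_sym.
- exact: rst_trans IH tw.
Qed.

End WordCongruence.

Section Coxeter.
Variables (S : choiceType) (adj : rel S).

Inductive coxeter_rel : seq S -> seq S -> Prop :=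
| coxeter_sq i : coxeter_rel [:: i; i] [::]
| coxeter_braid i j : adj i j -> coxeter_rel [:: i; j; i] [:: j; i; j]
| coxeter_comm i j : ~~ adj i j -> coxeter_rel [:: i; j] [:: j; i].

Definition coxeter_eq : rel (seq S) := fun s t => `[< word_cong coxeter_rel s t >].

Lemma coxeter_eq_equiv : equiv_class_of coxeter_eq.
Proof.
split=> [s|s t|t s w]; first by apply/asboolP; exact: rst_refl.
  by apply/asboolP/asboolP; exact: rst_sym.
by move=> /asboolP st /asboolP tw; apply/asboolP; exact: rst_trans st tw.
Qed.
Canonical coxeter_equiv := EquivRelPack coxeter_eq_equiv.

(* As s_i^2 = 1, the presented group is already the presented monoid: words in
   the generators modulo the congruence generated by the relations, the
   inverse being given by word reversal. *)
Definition coxeter : Type := {eq_quot coxeter_eq}%qT.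
HB.instance Definition _ := Choice.on coxeter.
HB.instance Definition _ := EqQuotient.on coxeter.

Definition coxeter_class (s : seq S) : coxeter := (\pi_coxeter s)%qT.
Definition coxeter_one : coxeter := coxeter_class [::].
Definition coxeter_mul (x y : coxeter) : coxeter :=
  coxeter_class (repr x ++ repr y).
Definition coxeter_inv (x : coxeter) : coxeter := coxeter_class (rev (repr x)).

Lemma coxeter_classP s t :
  coxeter_class s = coxeter_class t <-> word_cong coxeter_rel s t.
Proof. by split=> [/eqP|st]; [|apply/eqP]; rewrite piE /=; [move/asboolP|apply/asboolP]. Qed.

Lemma coxeter_reprK x : coxeter_class (repr x) = x.
Proof. exact: reprK. Qed.

Lemma coxeter_classM s t :
  coxeter_mul (coxeter_class s) (coxeter_class t) = coxeter_class (s ++ t).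
Proof.
by apply/coxeter_classP/word_congM; apply/coxeter_classP; rewrite coxeter_reprK.
Qed.

Lemma coxeter_mulA : associative coxeter_mul.
Proof.
move=> x y z; rewrite -[x]coxeter_reprK -[y]coxeter_reprK -[z]coxeter_reprK.
by rewrite !coxeter_classM catA.
Qed.

Lemma coxeter_mul1 : left_id coxeter_one coxeter_mul.
Proof. by move=> x; rewrite -[x]coxeter_reprK coxeter_classM. Qed.

Lemma coxeter_mulr1 : right_id coxeter_one coxeter_mul.
Proof. by move=> x; rewrite -[x]coxeter_reprK coxeter_classM cats0. Qed.

Lemma word_cong_rev s : word_cong coxeter_rel (rev s ++ s) [::].
Proof.
elim: s => [|i s IHs]; first exact: rst_refl.
apply: rst_trans IHs; rewrite rev_cons cat_rcons; apply: rst_step.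
by exists (rev s), s, [:: i; i], [::]; split=> //; exact: coxeter_sq.
Qed.

Lemma coxeter_mulV : left_inverse coxeter_one coxeter_inv coxeter_mul.
Proof.
move=> x; rewrite -{2}[x]coxeter_reprK coxeter_classM.
by apply/coxeter_classP; exact: word_cong_rev.
Qed.

Lemma coxeter_mulrV : right_inverse coxeter_one coxeter_inv coxeter_mul.
Proof.
move=> x; rewrite -{1}[x]coxeter_reprK coxeter_classM; apply/coxeter_classP.
by rewrite -{1}[repr x]revK; exact: word_cong_rev.
Qed.

HB.instance Definition _ := isGroup.Build coxeter coxeter_mulA coxeter_mul1
  coxeter_mulr1 coxeter_mulV coxeter_mulrV.

Definition coxeter_gen (i : S) : coxeter := coxeter_class [:: i].

Definition coxeter_word (s : seq S) : coxeter := (\prod_(i <- s) coxeter_gen i)%g.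

Lemma coxeter_wordE s : coxeter_word s = coxeter_class s.
Proof.
rewrite /coxeter_word; elim: s => [|i s IHs]; first by rewrite big_nil.
by rewrite big_cons IHs; exact: coxeter_classM.
Qed.

Definition reduced_expr (s : seq S) (w : coxeter) : Prop :=
  coxeter_word s = w /\
  forall t, coxeter_word t = w -> size s <= size t.

Inductive comm_rel : seq S -> seq S -> Prop :=
| Comm_rel i j : i != j -> ~~ adj i j -> comm_rel [:: i; j] [:: j; i].

Definition fully_commutative (w : coxeter) : Prop :=
  forall s t, reduced_expr s w -> reduced_expr t w -> word_cong comm_rel s t.

Lemma reduced_expr_exists w : exists s, reduced_expr s w.
Proof.
pose has_len n := `[< exists2 s, size s = n & coxeter_word s = w >].
have ex_len : exists n, has_len n.
  exists (size (repr w)); apply/asboolP; exists (repr w) => //.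
  by rewrite coxeter_wordE coxeter_reprK.
case: (ex_minnP ex_len) => n /asboolP[s sz_s sw] min_n.
by exists s; split=> // t tw; rewrite sz_s; apply: min_n; apply/asboolP; exists t.
Qed.

Definition reduced_word (w : coxeter) : seq S :=
  projT1 (cid (reduced_expr_exists w)).

Lemma reduced_wordP w : reduced_expr (reduced_word w) w.
Proof. exact: projT2 (cid (reduced_expr_exists w)). Qed.

End Coxeter.

Arguments coxeter_gen {S} adj i.
Arguments coxeter_word {S} adj s.

Local Open Scope ring_scope.

(* Realised as a subring of the field of fractions of Z[v]. *)
Definition laurent_pred : {pred {fraction {poly int}}} := fun x =>
  `[< exists (p : {poly int}) (n : nat), x * tofrac 'X ^+ n = tofrac p >].

Lemma laurent_subring_closed : subring_closed laurent_pred.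
Proof.
split=> [|x y|x y].
- by apply/asboolP; exists 1, 0%N; rewrite expr0 mulr1 rmorph1.
- move=> /asboolP[p [n px]] /asboolP[q [m qy]]; apply/asboolP.
  exists (p * 'X^m - q * 'X^n), (n + m)%N.
  rewrite tofracB !tofracM -px -qy !tofracXn mulrBl exprD !mulrA; congr (_ - _).
  exact: mulrAC.
- move=> /asboolP[p [n px]] /asboolP[q [m qy]]; apply/asboolP.
  by exists (p * q), (n + m)%N; rewrite tofracM -px -qy exprD mulrACA.
Qed.
HB.instance Definition _ :=
  GRing.isSubringClosed.Build {fraction {poly int}} laurent_pred
    laurent_subring_closed.

Record laurent := Laurent {
  laurent_val :> {fraction {poly int}};
  laurent_valP : laurent_val \in laurent_pred
}.
HB.instance Definition _ := [isSub for laurent_val].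
HB.instance Definition _ := [Choice of laurent by <:].
HB.instance Definition _ := [SubChoice_isSubComNzRing of laurent by <:].

Lemma laurent_v_subproof : tofrac ('X : {poly int}) \in laurent_pred.
Proof. by apply/asboolP; exists 'X, 0%N; rewrite expr0 mulr1. Qed.

Lemma laurent_vV_subproof : (tofrac ('X : {poly int}))^-1 \in laurent_pred.
Proof.
apply/asboolP; exists 1, 1%N.
by rewrite expr1 mulVf ?rmorph1 // tofrac_eq0 polyX_eq0.
Qed.

Definition laurent_v : laurent := Laurent laurent_v_subproof.
Definition laurent_vV : laurent := Laurent laurent_vV_subproof.

Definition delta : laurent := laurent_v + laurent_vV.

Section TemperleyLieb.
Variables (S : choiceType) (adj : rel S).

Local Notation free_alg := {malg laurent[{fmonom S}]}.

Definition free_gen (i : S) : free_alg := << fmu i >>.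

Inductive tl_rel : free_alg -> free_alg -> Prop :=
| tl_sq i : tl_rel (free_gen i * free_gen i) (delta *: free_gen i)
| tl_braid i j : adj i j ->
    tl_rel (free_gen i * free_gen j * free_gen i) (free_gen i)
| tl_comm i j : ~~ adj i j ->
    tl_rel (free_gen i * free_gen j) (free_gen j * free_gen i).

(* The two-sided ideal generated by the differences of the two sides of the
   relations. *)
Inductive tl_idealP : free_alg -> Prop :=
| tl_ideal_rel x y : tl_rel x y -> tl_idealP (x - y)
| tl_ideal0 : tl_idealP 0
| tl_idealB x y : tl_idealP x -> tl_idealP y -> tl_idealP (x - y)
| tl_idealMl a x : tl_idealP x -> tl_idealP (a * x)
| tl_idealMr a x : tl_idealP x -> tl_idealP (x * a).

Definition tl_ideal : {pred free_alg} := fun x => `[< tl_idealP x >].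

Lemma tl_ideal_zmod_closed : zmod_closed tl_ideal.
Proof.
split=> [|x y /asboolP Ix /asboolP Iy]; apply/asboolP; first exact: tl_ideal0.
exact: tl_idealB.
Qed.
HB.instance Definition _ :=
  GRing.isZmodClosed.Build free_alg tl_ideal tl_ideal_zmod_closed.

Definition TL : Type := Quotient.quot tl_ideal.
HB.instance Definition _ := GRing.Zmodule.on TL.

Definition tl_class (x : free_alg) : TL := (\pi_(Quotient.quot tl_ideal) x)%qT.

Lemma tl_classP x y : tl_class x = tl_class y <-> tl_idealP (x - y).
Proof.
by split=> [/eqP|xy]; [|apply/eqP]; rewrite -Quotient.idealrBE;
  [move/asboolP|apply/asboolP].
Qed.

Lemma tl_reprK (x : TL) : tl_class (repr x) = x. Proof. exact: reprK. Qed.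

Lemma tl_classD x y : tl_class (x + y) = tl_class x + tl_class y.
Proof. exact: (@Quotient.pi_add _ tl_ideal). Qed.

Definition tl_one : TL := tl_class 1.
Definition tl_mul (x y : TL) : TL := tl_class (repr x * repr y).
Definition tl_scale (c : laurent) (x : TL) : TL := tl_class (c *: repr x).

Lemma tl_class_repr x : tl_idealP (repr (tl_class x) - x).
Proof. by apply/tl_classP; rewrite tl_reprK. Qed.

Lemma tl_idealD x y : tl_idealP x -> tl_idealP y -> tl_idealP (x + y).
Proof.
move=> Ix Iy; rewrite -[y]opprK -[- y]sub0r; apply: tl_idealB => //.
by apply: tl_idealB => //; exact: tl_ideal0.
Qed.

Lemma tl_classM x y : tl_mul (tl_class x) (tl_class y) = tl_class (x * y).
Proof.
apply/tl_classP; set x' := repr _; set y' := repr _.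
rewrite -[_ * y'](subrK (x * y')) -mulrBl -addrA -mulrBr.
by apply: tl_idealD; [apply: tl_idealMr|apply: tl_idealMl]; exact: tl_class_repr.
Qed.

Lemma tl_classZ c x : tl_scale c (tl_class x) = tl_class (c *: x).
Proof.
apply/tl_classP; rewrite -scalerBr -[_ - _]mul1r scalerAl.
by apply: tl_idealMl; exact: tl_class_repr.
Qed.

Lemma tl_mulA : associative tl_mul.
Proof.
move=> x y z; rewrite -[x]tl_reprK -[y]tl_reprK -[z]tl_reprK.
by rewrite !tl_classM mulrA.
Qed.

Lemma tl_mul1 : left_id tl_one tl_mul.
Proof. by move=> x; rewrite -[x]tl_reprK tl_classM mul1r. Qed.

Lemma tl_mulr1 : right_id tl_one tl_mul.
Proof. by move=> x; rewrite -[x]tl_reprK tl_classM mulr1. Qed.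

Lemma tl_mulDl : left_distributive tl_mul +%R.
Proof.
move=> x y z; rewrite -[x]tl_reprK -[y]tl_reprK -[z]tl_reprK.
by rewrite -tl_classD !tl_classM mulrDl tl_classD.
Qed.

Lemma tl_mulDr : right_distributive tl_mul +%R.
Proof.
move=> x y z; rewrite -[x]tl_reprK -[y]tl_reprK -[z]tl_reprK.
by rewrite -tl_classD !tl_classM mulrDr tl_classD.
Qed.

Lemma tl_ideal_coeff1 x : tl_idealP x -> x@_(mone : {fmonom S}) = 0.
Proof.
pose phi := mcoeff (mone : {fmonom S}) : free_alg -> laurent.
have phi_gen i : phi (free_gen i) = 0.
  by rewrite /phi mcoeffU; case: eqP => // /(congr1 (@fdeg _)); rewrite fdegU fdeg1.
have phiM a b : phi (a * b) = phi a * phi b by exact: rmorphM.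
have phiB a b : phi (a - b) = phi a - phi b by exact: raddfB.
rewrite -/(phi x); elim=> {x}
  [x y|||a x _ Ix|a x _ Ix]; rewrite ?phiM ?Ix ?mulr0 ?mul0r //.
- case=> [i|i j _|i j _]; rewrite phiB.
  + by rewrite phiM {3}/phi mcoeffZ -/(phi _) !phi_gen !mulr0 subr0.
  + by rewrite !phiM !phi_gen mulr0 subr0.
  + by rewrite !phiM !phi_gen mulr0 subr0.
- exact: raddf0.
- by move=> x y _ Ix _ Iy; rewrite phiB Ix Iy subr0.
Qed.

Lemma tl_one_neq0 : tl_one != 0.
Proof.
apply/eqP; have -> : 0 = tl_class 0.
  by apply: (@addrI _ (tl_class 0)); rewrite addr0 -tl_classD addr0.
move/tl_classP/tl_ideal_coeff1/eqP.
by rewrite subr0 mcoeff1 eqxx oner_eq0.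
Qed.

HB.instance Definition _ := GRing.Zmodule_isNzRing.Build TL
  tl_mulA tl_mul1 tl_mulr1 tl_mulDl tl_mulDr tl_one_neq0.

Lemma tl_scaleA a b x : tl_scale a (tl_scale b x) = tl_scale (a * b) x.
Proof. by rewrite -[x]tl_reprK !tl_classZ scalerA. Qed.

Lemma tl_scale1 : left_id 1 tl_scale.
Proof. by move=> x; rewrite -[x]tl_reprK tl_classZ scale1r. Qed.

Lemma tl_scaleDr : right_distributive tl_scale +%R.
Proof.
move=> a x y; rewrite -[x]tl_reprK -[y]tl_reprK.
by rewrite -tl_classD !tl_classZ scalerDr tl_classD.
Qed.

Lemma tl_scaleDl x : {morph tl_scale^~ x : a b / a + b}.
Proof. by move=> a b; rewrite /= -[x]tl_reprK !tl_classZ scalerDl tl_classD. Qed.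

HB.instance Definition _ := GRing.Zmodule_isLmodule.Build laurent TL
  tl_scaleA tl_scale1 tl_scaleDr tl_scaleDl.

Lemma tl_scaleAl a x y : tl_scale a (tl_mul x y) = tl_mul (tl_scale a x) y.
Proof.
rewrite -[x]tl_reprK -[y]tl_reprK.
by rewrite tl_classZ !tl_classM tl_classZ scalerAl.
Qed.

HB.instance Definition _ :=
  GRing.Lmodule_isLalgebra.Build laurent TL tl_scaleAl.

Lemma free_scaleAr (c : laurent) (x y : free_alg) : c *: (x * y) = x * (c *: y).
Proof.
apply/malgP => k; rewrite mcoeffZ mcoeffMl.
rewrite (mcoeffMlw _ (finmap.fsubset_refl _) (msuppZ_le c y)).
rewrite mulr_sumr; apply: eq_bigr => k1 _; rewrite mulr_sumr.
by apply: eq_bigr => k2 _; rewrite mcoeffZ mulrnAr mulrCA.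
Qed.

Lemma tl_scaleAr a x y : tl_scale a (tl_mul x y) = tl_mul x (tl_scale a y).
Proof.
rewrite -[x]tl_reprK -[y]tl_reprK.
by rewrite tl_classZ !tl_classM tl_classZ free_scaleAr.
Qed.

HB.instance Definition _ :=
  GRing.Lalgebra_isAlgebra.Build laurent TL tl_scaleAr.

Definition tl_gen (i : S) : TL := tl_class (free_gen i).

Definition tl_word (s : seq S) : TL := \prod_(i <- s) tl_gen i.

Lemma tl_word_comm s t : word_cong (comm_rel adj) s t -> tl_word s = tl_word t.
Proof.
elim=> {s t} [s t [a [b [u [v [uv -> ->]]]]]|s|s t _ ->|s t w _ -> _ ->] //.
rewrite /tl_word !big_cat /=; congr (_ * (_ * _)).
case: uv => i j _ nij; rewrite !big_cons !big_nil !mulr1.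
apply: etrans (tl_classM _ _) (etrans _ (esym (tl_classM _ _))).
by apply/tl_classP/tl_ideal_rel/tl_comm.
Qed.

(* The element e_w, for w fully commutative; [reduced_word w] is some reduced
   expression of w, and any other one gives the same element of [TL]. *)
Definition tl_basis (w : coxeter adj) : TL := tl_word (reduced_word w).

Lemma tl_basisE w s :
  fully_commutative w -> reduced_expr s w -> tl_word s = tl_basis w.
Proof. by move=> fcw red_s; apply/tl_word_comm/fcw => //; exact: reduced_wordP. Qed.

End TemperleyLieb.

Arguments tl_gen {S} adj i.
Arguments tl_word {S} adj s.

(* Main.v *)
Require Import Defs.
From HB Require Import structures.
From Stdlib Require Import Relations.
From mathcomp Require Import all_boot all_order all_algebra.
From mathcomp Require Import boolp zify finmap.
From mathcomp.multinomials Require Import monalg.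

(** The exponent of delta in a word can be counted by a combinatorial
representation of the Temperley-Lieb algebra at v = 1, where delta = 2.

Read a word from left to right while holding a finitely supported vector f
over the field with two elements, indexed by the generators, starting at 0.
A letter i may be read only if f sums to zero over the neighbours of i; it
then either toggles the coordinate f_i or leaves it alone.  Let [loops s] be
the number of ways of reading s that end at 0.  Toggling satisfies the
Temperley-Lieb relations with delta = 2 ([toggle_sq], [toggle_braid],
[toggle_comm]), so an identity s = delta ^ m e_w gives
loops s = 2 ^ m loops w ([loops_tl_word]).  In the language of heaps, the
readings form the kernel of the boundary map from edges (pairs of consecutive
vertices with the same label) to vertices.

The readings of a word form a vector space.  Omitting a letter removes one
coordinate and one linear condition, so [loops] changes by a factor at most 2
in either direction ([loops_delete_leq], [loops_insert_leq]).  Part (i)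
follows once loops w = 1 for w fully commutative, and part (ii) once the words
obtained from a reduced expression of w by omitting a letter also have exactly
one loop.  A word with these two properties is called rigid.

A reduced expression of a fully commutative element is contraction free: no
word in its commutation class has a factor i i or i j i with i and j adjacent
([contraction_free_reduced]).  Its heap then has property P2
([word_heap_P2]), and regularity gives property P1: either the heap is trivial and
the word has no repeated letter, or the last step of the sequence shows that
the word can be rewritten as u b a or a b u with a
and b adjacent ([word_heap_P1]).  Rigidity follows by induction on the length
([contraction_free_rigid]).  At the vacuum 0, the toggle of a is absorbed by
that of an adjacent b ([loops_tail]), so u b a has as many loops as the
shorter word u b.  The one delicate omission is that of b, which leaves u a.
If u a is contraction free, induction applies.  If not, the contraction can
only be a j a with the new a at the end, so u can be written x a j y where a
commutes with y, and contracting a j a shows that u a has as many loops as the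
omission x a y of u, to which induction applies ([rigid_omit]). *)

Set Implicit Arguments.
Unset Strict Implicit.
Unset Printing Implicit Defensive.

Import GRing.Theory.

(** * Toggle walks over the field with two elements *)

Section ToggleWalks.
Variables (S : eqType) (adj : rel S).
Implicit Types (i j a b : S) (h s u v : seq S) (F G : seq S -> nat).

(** A vector over the field with two elements is represented by any sequence
    of toggles that produces it from 0.  Quantifying over all predicates instead
    of single letters makes the parity of a set of neighbours immediate. *)
Definition same_parity h h' := forall p : pred S, odd (count p h) = odd (count p h').

(** The generator acts on functions of the vector, so that a word acts by the
    composition of its letters in the order in which they are written. *)
Definition toggle i F h : nat :=
  if odd (count (adj i) h) then 0 else F h + F (i :: h).

Definition toggles s F : seq S -> nat := foldr toggle F s.

Definition is_zero h : nat := `[< same_parity h [::] >].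

Definition loops s : nat := toggles s is_zero [::].

Definition parity_stable F := forall h h', same_parity h h' -> F h = F h'.

Lemma same_parity_cons i h h' : same_parity h h' -> same_parity (i :: h) (i :: h').
Proof. by move=> hh' p; rewrite /= !oddD hh'. Qed.

Lemma same_parity_perm h h' : perm_eq h h' -> same_parity h h'.
Proof. by move=> /permP hh' p; rewrite hh'. Qed.

Lemma same_parity_cancel i h : same_parity [:: i, i & h] h.
Proof. by move=> p; rewrite /= !oddD addbA addbb. Qed.

Lemma is_zero_stable : parity_stable is_zero.
Proof.
move=> h h' hh'; rewrite /is_zero; congr nat_of_bool.
by apply/asboolP/asboolP => h0 p; rewrite -h0.
Qed.

Lemma toggle_stable i F : parity_stable F -> parity_stable (toggle i F).
Proof.
move=> stF h h' hh'; rewrite /toggle hh' (stF _ _ hh').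
by rewrite (stF _ _ (same_parity_cons i hh')).
Qed.

Lemma toggles_stable s F : parity_stable F -> parity_stable (toggles s F).
Proof. by move=> stF; elim: s => //= i s; apply: toggle_stable. Qed.

Lemma toggles_cat s u F : toggles (s ++ u) F = toggles s (toggles u F).
Proof. exact: foldr_cat. Qed.

Lemma toggles_cons i s F : toggles (i :: s) F = toggle i (toggles s F).
Proof. by []. Qed.

Lemma eq_toggles s F G : F =1 G -> toggles s F =1 toggles s G.
Proof. by move=> FG; elim: s => //= i s IHs h; rewrite /toggle !IHs. Qed.

Lemma togglesD s F G :
  toggles s (fun h => F h + G h) =1 fun h => toggles s F h + toggles s G h.
Proof.
elim: s => //= i s IHs h; rewrite /toggle !IHs.
by case: ifP => // _; rewrite addnACA.
Qed.

Lemma leq_toggles s F G :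
  (forall h, F h <= G h) -> forall h, toggles s F h <= toggles s G h.
Proof.
move=> FG; elim: s => //= i s IHs h; rewrite /toggle.
by case: ifP => // _; apply: leq_add.
Qed.

Hypotheses (adj_irr : irreflexive adj) (adj_sym : symmetric adj).

Lemma toggle_sq i F : parity_stable F ->
  toggle i (toggle i F) =1 fun h => 2 * toggle i F h.
Proof.
move=> stF h; rewrite /toggle /= adj_irr add0n; case: (odd _) => //.
by rewrite (stF _ _ (same_parity_cancel i h)); lia.
Qed.

(** Toggling i changes the neighbour sum of j, so exactly one of the two choices
    for the first i permits j; symmetrically j may then not be toggled, since
    otherwise the second i would be blocked. *)
Lemma toggle_braid i j F : adj i j -> parity_stable F ->
  toggle i (toggle j (toggle i F)) =1 toggle i F.
Proof.
move=> ij stF h; have ji : adj j i by rewrite adj_sym.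
rewrite {1 4}/toggle; case: ifP => // ih.
have toggle_j h' : odd (count (adj i) h') = false ->
    toggle j (toggle i F) h' = if odd (count (adj j) h') then 0 else toggle i F h'.
  move=> ih'; rewrite {1}/toggle; case: ifP => // _.
  by rewrite [toggle i F (j :: h')]/toggle /= ij oddD ih' addn0.
rewrite !toggle_j //= ?adj_irr // ji add1n /=.
case: (odd _) => /=; rewrite ?add0n ?addn0 /toggle /= ?adj_irr ?add0n ih //.
by rewrite addnC (stF _ _ (same_parity_cancel i h)).
Qed.

Lemma toggle_comm i j F : ~~ adj i j -> parity_stable F ->
  toggle i (toggle j F) =1 toggle j (toggle i F).
Proof.
move=> nij stF h; have nji : ~~ adj j i by rewrite adj_sym.
rewrite /toggle /= (negbTE nij) (negbTE nji) !add0n.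
case: ifP => ih; case: ifP => // jh.
rewrite addnACA -!addnA; congr (_ + (_ + (_ + _))); apply: stF.
by apply: same_parity_perm; apply/permP => p /=; lia.
Qed.

(** The function F is a multiple of the indicator of a linear subspace of
    vectors extended by one more coordinate c.  The extra coordinate records the
    value of a linear form on readings, whose kernel contains at least half of
    them. *)
Definition graded_linear (F : seq S -> bool -> nat) :=
  forall h c, 0 < F h c -> forall h' c', F (h ++ h') (c (+) c') = F h' c'.

Definition graded_stable (F : seq S -> bool -> nat) := forall c, parity_stable (F^~ c).

Lemma graded_linear_toggle i (F : seq S -> bool -> nat) : graded_stable F ->
  graded_linear F -> graded_linear (fun h c => toggle i (F^~ c) h).
Proof.
move=> stF linF h c; rewrite /toggle; case: ifP => // ih.
rewrite addn_gt0 => Fpos h' c'; rewrite count_cat oddD ih addFb.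
case: ifP => // ih'; case/orP: Fpos => Fpos.
  rewrite linF // -(linF _ _ Fpos (i :: h') c').
  congr (_ + _); apply: stF; apply: same_parity_perm.
  by apply/permP => p /=; rewrite !count_cat /=; lia.
have -> : F (i :: h ++ h') (c (+) c') = F h' c' by exact: (linF _ _ Fpos).
rewrite addnC -(linF _ _ Fpos (i :: h') c'); congr (_ + _); apply: stF.
move=> p; rewrite /= !count_cat /= !oddD; move: (odd (p i)) (odd _) (odd _).
by case; case; case.
Qed.

Lemma graded_linear_toggles s (F : seq S -> bool -> nat) : graded_stable F ->
  graded_linear F -> graded_linear (fun h c => toggles s (F^~ c) h).
Proof.
move=> stF linF; elim: s => //= i s.
apply: (@graded_linear_toggle i (fun h c => toggles s (F^~ c) h)) => c.
exact: (toggles_stable s (stF c)).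
Qed.

(** The readings with odd grade are empty or a translate of those with even
    grade. *)
Lemma leq_odd_part s (F : seq S -> bool -> nat) : graded_stable F -> graded_linear F ->
  toggles s (F^~ true) [::] <= toggles s (F^~ false) [::].
Proof.
move=> stF linF; have [-> //|Fpos] := posnP (toggles s (F^~ true) [::]).
by rewrite -(graded_linear_toggles stF linF Fpos [::] true).
Qed.

Lemma toggles_linear s : graded_linear (fun h _ => toggles s is_zero h).
Proof.
apply: (@graded_linear_toggles s (fun h _ => is_zero h)) => [c|h _].
  exact: is_zero_stable.
rewrite lt0b => /asboolP h0 h' _; apply: is_zero_stable => p.
by rewrite count_cat oddD h0 addFb.
Qed.

Lemma toggles_is_zero_cat s h h' : 0 < toggles s is_zero h ->
  toggles s is_zero (h ++ h') = toggles s is_zero h'.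
Proof. by move=> hpos; exact: (@toggles_linear s h true hpos h' true). Qed.

(** Grade the readings of u v by the neighbour sum of i at the junction.  Those
    of grade 0 extend to readings of u i v that do not toggle i there. *)
Lemma loops_delete_leq i u v : loops (u ++ v) <= 2 * loops (u ++ i :: v).
Proof.
rewrite /loops !toggles_cat toggles_cons; set F := toggles v is_zero.
have stF : parity_stable F by apply: toggles_stable; exact: is_zero_stable.
pose Fc h (c : bool) := if odd (count (adj i) h) == c then F h else 0.
have stFc : graded_stable Fc.
  by move=> c h h' hh'; rewrite /Fc hh' (stF _ _ hh').
have linFc : graded_linear Fc.
  move=> h c; rewrite /Fc; case: eqP => // <- Fpos h' c'.
  rewrite count_cat oddD (can_eq (addKb _)).
  by rewrite /F toggles_is_zero_cat.
have splitF h : F h = Fc h false + Fc h true by rewrite /Fc; case: odd; rewrite ?addn0.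
rewrite (eq_toggles _ splitF) togglesD mul2n -addnn.
apply: leq_trans (leq_add (leqnn _) (leq_odd_part u stFc linFc)) _.
by apply: leq_add; apply: leq_toggles => h; rewrite /Fc /toggle;
  case: odd => //=; apply: leq_addr.
Qed.

(** Grade the readings of u i v by the choice made at i.  Those that do not
    toggle i are readings of u v. *)
Lemma loops_insert_leq i u v : loops (u ++ i :: v) <= 2 * loops (u ++ v).
Proof.
rewrite /loops !toggles_cat toggles_cons; set F := toggles v is_zero.
have stF : parity_stable F by apply: toggles_stable; exact: is_zero_stable.
pose Fc h (c : bool) :=
  if odd (count (adj i) h) then 0 else F (if c then i :: h else h).
have stFc : graded_stable Fc.
  move=> c h h' hh'; rewrite /Fc hh'; case: ifP => // _; apply: stF.
  by case: c => //; exact: same_parity_cons.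
have linFc : graded_linear Fc.
  move=> h c; rewrite /Fc; case: ifP => // ih Fpos h' c'.
  rewrite count_cat oddD ih addFb; case: ifP => // _.
  rewrite -[RHS](toggles_is_zero_cat _ Fpos); apply: stF => p.
  by case: c c' {Fpos} => [] [] /=; rewrite !count_cat /= !oddD;
    move: (odd (p i)) (odd _) (odd _) => [] [] [].
have splitF h : toggle i F h = Fc h false + Fc h true by rewrite /Fc /toggle; case: ifP.
rewrite (eq_toggles _ splitF) togglesD mul2n -addnn.
apply: leq_trans (leq_add (leqnn _) (leq_odd_part u stFc linFc)) _.
by apply: leq_add; apply: leq_toggles => h; rewrite /Fc; case: odd.
Qed.

(** A final toggle of a is forced by the requirement to end at 0.  If a
    coordinate a were left to be cleared, the adjacent letter b just before it
    would have been blocked. *)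
Lemma loops_tail a b u : adj a b -> loops (u ++ [:: b; a]) = loops (u ++ [:: b]).
Proof.
move=> ab; have ba : adj b a by rewrite adj_sym.
rewrite /loops !toggles_cat; apply: eq_toggles => h /=.
rewrite [LHS]/toggle [RHS]/toggle; case: ifP => // bh.
have nza h' : odd (count (adj b) h') = false -> is_zero (a :: h') = 0.
  move=> bh'; apply/eqP; rewrite eqb0; apply/asboolP => /(_ (adj b)).
  by rewrite /= ba oddD bh'.
have toggle_a h' : odd (count (adj b) h') = false -> toggle a is_zero h' = is_zero h'.
  move=> bh'; rewrite /toggle nza // addn0; case: ifP => // ah'.
  by apply/esym/eqP; rewrite eqb0; apply/asboolP => /(_ (adj a)); rewrite ah'.
by rewrite !toggle_a //= adj_irr.
Qed.

(** After toggling a from the vacuum, the adjacent letter b is blocked. *)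
Lemma loops_head a b u : adj a b -> loops [:: a, b & u] = loops (b :: u).
Proof.
move=> ab; rewrite /loops /=; set F := toggles u is_zero.
have ba : adj b a by rewrite adj_sym.
by rewrite {1}/toggle [toggle b F [:: a]]/toggle /= ba /= addn0.
Qed.

Lemma toggles_unreachable s i h : i \notin s -> odd (count_mem i h) ->
  toggles s is_zero h = 0.
Proof.
elim: s h => [|j s IHs] h /=.
  by move=> _ ih; apply/eqP; rewrite eqb0; apply/asboolP => /(_ (pred1 i)); rewrite ih.
rewrite inE negb_or => /andP[ij is_] ih; rewrite /toggle !IHs //=; first by case: ifP.
by rewrite eq_sym (negbTE ij).
Qed.

Lemma loops_uniq s : uniq s -> loops s = 1.
Proof.
rewrite /loops; elim: s => [_|i s IHs /= /andP[is_ us]].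
  by rewrite /= /is_zero asboolT.
by rewrite {1}/toggle /= IHs // (toggles_unreachable is_) //= eqxx.
Qed.

Lemma loops_congr s t u v :
    (forall F, parity_stable F -> toggles u F =1 toggles v F) ->
  loops (s ++ u ++ t) = loops (s ++ v ++ t).
Proof.
move=> uv; rewrite /loops !toggles_cat; apply: eq_toggles; apply: uv.
by apply: toggles_stable; exact: is_zero_stable.
Qed.

Lemma loops_braid i j u v : adj i j ->
  loops (u ++ [:: i; j; i] ++ v) = loops (u ++ [:: i] ++ v).
Proof. by move=> ij; apply: loops_congr => F stF; exact: toggle_braid. Qed.

Lemma loops_swap i j u v : ~~ adj i j ->
  loops (u ++ [:: i; j] ++ v) = loops (u ++ [:: j; i] ++ v).
Proof. by move=> ij; apply: loops_congr => F stF; exact: toggle_comm. Qed.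

Lemma loops_sq i u v : loops (u ++ [:: i; i] ++ v) = 2 * loops (u ++ [:: i] ++ v).
Proof.
rewrite /loops !toggles_cat mul2n -addnn -togglesD; apply: eq_toggles => h.
rewrite /= toggle_sq ?mul2n ?addnn //.
by apply: toggles_stable; exact: is_zero_stable.
Qed.

End ToggleWalks.

(** * Specialising the Temperley-Lieb algebra at v = 1 *)

Section LoopTrace.
Local Open Scope ring_scope.

Lemma laurent_as_fraction (x : laurent) : exists pn : {poly int} * nat,
  laurent_val x * tofrac 'X ^+ pn.2 = tofrac pn.1.
Proof. by have /asboolP[p [n xp]] := laurent_valP x; exists (p, n). Qed.

(** A Laurent polynomial is p / 'X ^+ n, and its value at 1 is that of p. *)
Definition laurent_at1 (x : laurent) : int :=
  (projT1 (cid (laurent_as_fraction x))).1.[1].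

Lemma laurent_at1E (x : laurent) p n :
  laurent_val x * tofrac 'X ^+ n = tofrac p -> laurent_at1 x = p.[1].
Proof.
rewrite /laurent_at1; case: cid => -[q m] /= xq xp.
have /eqP : tofrac (q * 'X^n) = tofrac (p * 'X^m).
  by rewrite !tofracM -xq -xp !tofracXn mulrAC.
rewrite tofrac_eq => /eqP/(congr1 (fun r => r.[1])).
by rewrite !hornerM !hornerXn !expr1n !mulr1.
Qed.

Fact laurent_at1_zmod : zmod_morphism laurent_at1.
Proof.
move=> x y; have [[p n] /= xp] := laurent_as_fraction x.
have [[q m] /= yq] := laurent_as_fraction y.
rewrite (laurent_at1E xp) (laurent_at1E yq).
rewrite (@laurent_at1E _ (p * 'X^m - q * 'X^n) (n + m)%N).
  by rewrite hornerD hornerN !hornerM !hornerXn !expr1n !mulr1.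
rewrite tofracB !tofracM -xp -yq !tofracXn mulrBl exprD !mulrA; congr (_ - _).
exact: mulrAC.
Qed.

Fact laurent_at1_monoid : monoid_morphism laurent_at1.
Proof.
split; first by rewrite (@laurent_at1E _ 1 0) ?hornerC // expr0 mulr1 rmorph1.
move=> x y; have [[p n] /= xp] := laurent_as_fraction x.
have [[q m] /= yq] := laurent_as_fraction y.
rewrite (laurent_at1E xp) (laurent_at1E yq) -hornerM.
by apply: (@laurent_at1E _ _ (n + m)); rewrite tofracM -xp -yq exprD mulrACA.
Qed.

HB.instance Definition _ :=
  GRing.isZmodMorphism.Build laurent int laurent_at1 laurent_at1_zmod.
HB.instance Definition _ :=
  GRing.isMonoidMorphism.Build laurent int laurent_at1 laurent_at1_monoid.

Lemma laurent_at1_delta : laurent_at1 delta = 2.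
Proof.
rewrite rmorphD /= (@laurent_at1E _ 'X 0) ?expr0 ?mulr1 // hornerX.
rewrite (@laurent_at1E _ 1 1) ?hornerC // expr1 mulVf ?rmorph1 //.
by rewrite tofrac_eq0 polyX_eq0.
Qed.

Variables (S : choiceType) (adj : rel S).
Hypotheses (adj_irr : irreflexive adj) (adj_sym : symmetric adj).

Local Notation free_alg := {malg laurent[{fmonom S}]}.

(** A matrix coefficient of the representation, extended linearly to the free
    algebra.  The margins u and v make the family of these functionals stable
    under multiplication on both sides, so that vanishing on the relations
    propagates to the two-sided ideal they generate. *)
Definition loop_trace (u v : seq S) : free_alg -> int :=
  mmap laurent_at1 (fun k : {fmonom S} => (loops adj (u ++ k ++ v))%:Z).
HB.instance Definition _ u v :=
  GRing.Additive.copy (loop_trace u v) (mmap laurent_at1 _).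

Lemma loop_traceU u v c k :
  loop_trace u v << c *g k >> = laurent_at1 c * (loops adj (u ++ k ++ v))%:Z.
Proof. exact: mmapU. Qed.

Lemma loop_traceMl u v (a x : free_alg) : loop_trace u v (a * x) =
  \sum_(k <- msupp a) laurent_at1 a@_k * loop_trace (u ++ k) v x.
Proof.
rewrite malgME raddf_sum /=; apply: eq_bigr => k1 _.
rewrite raddf_sum [loop_trace _ _ x]mmapE mulr_sumr; apply: eq_bigr => k2 _.
by rewrite /= loop_traceU rmorphM fmM -mulrA !catA.
Qed.

Lemma loop_traceMr u v (a x : free_alg) : loop_trace u v (x * a) =
  \sum_(k <- msupp a) laurent_at1 a@_k * loop_trace u (k ++ v) x.
Proof.
rewrite malgME raddf_sum /=.
under eq_bigr => k1 _ do rewrite raddf_sum /=.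
rewrite exchange_big /=; apply: eq_bigr => k2 _.
rewrite [loop_trace _ _ x]mmapE mulr_sumr; apply: eq_bigr => k1 _.
by rewrite /= loop_traceU rmorphM fmM -!catA [_ a@__ * _ in RHS]mulrCA !mulrA.
Qed.

Lemma monomialM (k l : {fmonom S}) :
  << k >> * << l >> = << mmul k l >> :> free_alg.
Proof. by rewrite malgM_def fgmulUU mulr1. Qed.

Lemma loop_trace_ideal u v x : tl_idealP adj x -> loop_trace u v x = 0.
Proof.
move=> Ix; elim: Ix u v => {x} [x y xy||x y _ IHx _ IHy|a x _ IHx|a x _ IHx] u v.
- rewrite raddfB /=; apply/eqP; rewrite subr_eq0; apply/eqP.
  case: xy => [i|i j ij|i j ij]; rewrite /free_gen ?monomialM.
  + rewrite -mul_malgC malgM_def fgmulUU !mulr1 mul1m.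
    rewrite !loop_traceU laurent_at1_delta rmorph1 mul1r !fmM !fmU /=.
    by rewrite (loops_sq adj_irr).
  + by rewrite !loop_traceU !fmM !fmU /= (loops_braid adj_irr adj_sym _ _ ij).
  + by rewrite !loop_traceU !fmM !fmU /= (loops_swap adj_sym _ _ ij).
- exact: raddf0.
- by rewrite raddfB /= IHx IHy subrr.
- by rewrite loop_traceMl big1 // => k _; rewrite IHx mulr0.
- by rewrite loop_traceMr big1 // => k _; rewrite IHx mulr0.
Qed.

Lemma tl_word_monomial s : tl_word adj s = tl_class adj << FMonom s >>.
Proof.
rewrite /tl_word; elim: s => [|i s IHs].
  by rewrite big_nil; congr (tl_class _ << _ >>); apply: val_inj; rewrite /= fm1.
rewrite big_cons IHs; apply: etrans (tl_classM _ _ _) _.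
by rewrite monomialM; congr (tl_class _ << _ >>); apply: val_inj; rewrite /= fmM fmU.
Qed.

Lemma loops_tl_word s t m :
  tl_word adj s = delta ^+ m *: tl_word adj t ->
  loops adj s = (2 ^ m * loops adj t)%N.
Proof.
rewrite !tl_word_monomial => st.
have {st} /tl_classP/(loop_trace_ideal [::] [::]) := etrans st (tl_classZ _ _ _).
move/eqP; rewrite raddfB /= subr_eq0 -mul_malgC malgM_def fgmulUU mul1m mulr1.
rewrite !loop_traceU rmorph1 rmorphXn /= laurent_at1_delta !cats0 mul1r.
move=> /eqP st; apply: (can_inj (@absz_nat)); rewrite st PoszM.
by congr (_ * _); rewrite -natz natrX.
Qed.

End LoopTrace.

(** * Commutation classes of words *)

Section CommutationClasses.
Variables (S : choiceType) (adj : rel S).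
Hypotheses (adj_irr : irreflexive adj) (adj_sym : symmetric adj).
Implicit Types (i j a b : S) (s t u v x y : seq S).

Local Notation "s ~ t" := (word_cong (comm_rel adj) s t) (at level 70).

Lemma comm_step_sym s t :
  word_step (comm_rel adj) s t -> word_step (comm_rel adj) t s.
Proof.
case=> x [y [u [v [uv -> ->]]]]; exists x, y, v, u; split=> //.
by case: uv => i j ij nij; apply: Comm_rel; rewrite 1?eq_sym // adj_sym.
Qed.

(** Commutation moves are reversible, so a preorder that contains the single
    moves contains the whole congruence, without a case for symmetry. *)
Lemma comm_cong_ind (Q : seq S -> seq S -> Prop) :
    (forall s, Q s s) -> (forall s t u, Q s t -> Q t u -> Q s u) ->
    (forall s t, word_step (comm_rel adj) s t -> Q s t) ->
  forall s t, s ~ t -> Q s t.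
Proof.
move=> Qrefl Qtrans Qstep s t /clos_rst_rst1n_iff; elim=> {s t} // s t u st _.
by apply: Qtrans; case: st => [|/comm_step_sym]; exact: Qstep.
Qed.

Lemma comm_cong_refl s : s ~ s. Proof. exact: rst_refl. Qed.

Lemma comm_cong_sym s t : s ~ t -> t ~ s. Proof. exact: rst_sym. Qed.

Lemma comm_cong_trans t s u : s ~ t -> t ~ u -> s ~ u.
Proof. exact: rst_trans. Qed.

Hint Resolve comm_cong_refl : core.

Lemma comm_cong_perm s t : s ~ t -> perm_eq s t.
Proof.
move: s t; apply: (@comm_cong_ind (fun s t => perm_eq s t))
  => [s|s t u|s t [x [y [u [v [uv -> ->]]]]]] //.
  exact: perm_trans.
rewrite perm_cat2l perm_cat2r; case: uv => i j _ _.
by apply/permP => p /=; lia.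
Qed.

Lemma comm_cong_rev s t : s ~ t -> rev s ~ rev t.
Proof.
move: s t; apply: (@comm_cong_ind (fun s t => rev s ~ rev t))
  => [s|s t u|s t [x [y [u [v [uv -> ->]]]]]] //.
  exact: rst_trans.
rewrite !rev_cat -!catA; do 2 apply: word_congM => //; apply: comm_cong_sym.
by apply: word_cong_step; case: uv.
Qed.

Definition commutes_with a : pred S := fun j => (j != a) && ~~ adj j a.

Lemma comm_cong_move a y : all (commutes_with a) y -> a :: y ~ y ++ [:: a].
Proof.
elim: y => //= j y IHy /andP[/andP[ja nja] ya].
apply: (@comm_cong_trans (j :: a :: y)).
  apply: (@word_congM _ _ [:: a; j] [:: j; a] y y) => //; apply: word_cong_step.
  by apply: Comm_rel; rewrite 1?eq_sym // adj_sym.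
exact: (@word_congM _ _ [:: j] [:: j] _ _ _ (IHy ya)).
Qed.

Inductive deletion : seq S -> seq S -> Prop :=
| deletion_head i s : deletion (i :: s) s
| deletion_cons i s s' : deletion s s' -> deletion (i :: s) (i :: s').

Lemma deletion_catr x s s' : deletion s s' -> deletion (x ++ s) (x ++ s').
Proof. by move=> ss'; elim: x => //= i x; exact: deletion_cons. Qed.

Lemma deletion_catl y s s' : deletion s s' -> deletion (s ++ y) (s' ++ y).
Proof. by elim=> {s s'} [i s|i s s' _]; [exact: deletion_head|exact: deletion_cons]. Qed.

Lemma deletion_cat x y z : deletion (x ++ y) z ->
  (exists2 x', deletion x x' & z = x' ++ y) \/
  (exists2 y', deletion y y' & z = x ++ y').
Proof.
elim: x z => [|i x IHx] z /=; first by right; exists z.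
move E: (i :: _) => s sz; case: sz E => [j t [-> <-]|j t t' tt' [-> Et]].
  by left; exists x => //; exact: deletion_head.
rewrite -Et in tt'; case: (IHx _ tt') => [[x' xx' ->]|[y' yy' ->]].
  by left; exists (j :: x') => //; exact: deletion_cons.
by right; exists y'.
Qed.

Lemma deletion_seq1 i s : deletion [:: i] s -> s = [::].
Proof.
move E: [:: i] => t ts; case: ts E => [j r [_ <-]|j r r' rr' [_ Er]] //.
by case: rr' Er.
Qed.

Lemma deletion_rev s s' : deletion s s' -> deletion (rev s) (rev s').
Proof.
elim=> {s s'} [i s|i s s' _ IHs]; rewrite !rev_cons -!cats1.
  by rewrite -[X in deletion _ X]cats0; apply/deletion_catr/deletion_head.
exact: deletion_catl.
Qed.

Lemma deletion_take_drop l s : l < size s -> deletion s (take l s ++ drop l.+1 s).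
Proof.
elim: s l => //= i s IHs [|l] ls; first by rewrite drop0; exact: deletion_head.
exact/deletion_cons/IHs.
Qed.

Lemma deletion_comm_cong s t t' : s ~ t -> deletion t t' ->
  exists2 s', deletion s s' & s' ~ t'.
Proof.
move=> st; move: s t st t'.
apply: (@comm_cong_ind (fun s t => forall t', deletion t t' ->
  exists2 s', deletion s s' & s' ~ t'))
  => [s t' tt'|s t w st tw w' ww'|s t [x [y [u [v [uv -> ->]]]]] t'].
- by exists t'.
- have [t' /st[s' ss' st'] tw'] := tw _ ww'.
  by exists s' => //; exact: comm_cong_trans st' tw'.
have uv' : u ~ v by exact: word_cong_step.
case/deletion_cat => [[x' xx' ->]|[z']].
  by exists (x' ++ u ++ y); [exact: deletion_catl|do 2 apply: word_congM => //].
case/deletion_cat => [[v' vv' ->] ->|[y' yy' ->] ->]; last first.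
  exists (x ++ u ++ y'); first by do 2 apply: deletion_catr.
  by do 2 apply: word_congM => //.
suff [u' uu' ->] : exists2 u', deletion u u' & v' = u'.
  by exists (x ++ u' ++ y) => //; apply/deletion_catr/deletion_catl.
case: uv vv' => i j _ _ /(@deletion_cat [:: j])[[w wj ->]|[w wi ->]].
  exists [:: i]; first exact/deletion_cons/deletion_head.
  by rewrite (deletion_seq1 wj).
exists [:: j]; first exact: deletion_head.
by rewrite (deletion_seq1 wi).
Qed.

(** Tracks one occurrence of a that can be moved to the end of the word by
    commutations, together with the word of the other letters.  This remembers
    where the last letter of u a went in a commutation-equivalent word. *)
Inductive pulls a : seq S -> seq S -> Prop :=
| pulls_head s : all (commutes_with a) s -> pulls a (a :: s) s
| pulls_cons i s s' : pulls a s s' -> pulls a (i :: s) (i :: s').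

Lemma pulls_consE a i s s' : pulls a (i :: s) s' ->
  [/\ i = a, all (commutes_with a) s & s' = s] \/ (exists2 s1, pulls a s s1 & s' = i :: s1).
Proof.
move E: (i :: s) => t ts'; case: ts' E => [r ra [-> ->]|j r r' rr' [-> ->]]; first by left.
by right; exists r'.
Qed.

Lemma pulls_nil a s : ~ pulls a [::] s.
Proof. by move E: [::] => t ts; case: ts E. Qed.

Lemma pulls_cat a x y z : pulls a (x ++ y) z ->
  (exists2 y', pulls a y y' & z = x ++ y') \/
  (exists x', [/\ pulls a x x', all (commutes_with a) y & z = x' ++ y]).
Proof.
elim: x z => [|i x IHx] z /=; first by left; exists z.
case/pulls_consE => [[-> + ->]|[z1 + ->]].
  by rewrite all_cat => /andP[xa ya]; right; exists x; split=> //; exact: pulls_head.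
case/IHx => [[y' yy' ->]|[x' [xx' ya ->]]]; first by left; exists y'.
by right; exists (i :: x'); split=> //; exact: pulls_cons.
Qed.

Lemma pulls_last a u : pulls a (u ++ [:: a]) u.
Proof. by elim: u => [|i u IHu] /=; [exact: pulls_head|exact: pulls_cons]. Qed.

Lemma pulls_comm_cong a s s' t : s ~ t -> pulls a s s' ->
  exists2 t', pulls a t t' & s' ~ t'.
Proof.
move=> st; move: s t st s'.
apply: (@comm_cong_ind (fun s t => forall s', pulls a s s' ->
  exists2 t', pulls a t t' & s' ~ t'))
  => [s t' tt'|s t w st tw s' /st[t' /tw[w' ww' tw'] st']|].
- by exists t'.
- by exists w' => //; exact: comm_cong_trans st' tw'.
move=> s t [x [y [u [v [uv -> ->]]]]] s'; have uv' : u ~ v by exact: word_cong_step.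
elim: x s' => [|k x IHx] s' /=; last first.
  case/pulls_consE => [[-> xa ->]|[s1 /IHx[t' tt' st'] ->]].
    have xuvy : x ++ u ++ y ~ x ++ v ++ y by do 2 apply: word_congM => //.
    exists (x ++ v ++ y) => //.
    by apply: pulls_head; rewrite -(perm_all _ (comm_cong_perm xuvy)).
  exists (k :: t'); first exact: pulls_cons.
  exact: (@word_congM _ _ [:: k] [:: k]).
case: uv uv' => i j ij nij uv' /=.
case/pulls_consE => [[Ei /= /andP[ja ya] ->]|[s1 + ->]].
  exists (j :: y) => //; apply: pulls_cons; rewrite Ei; exact: pulls_head.
case/pulls_consE => [[Ej ya ->]|[s2 ys2 ->]].
  exists (i :: y) => //; rewrite Ej; apply: pulls_head => /=.
  by rewrite ya andbT /commutes_with -Ej ij.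
exists [:: j, i & s2]; first by do 2 apply: pulls_cons.
exact: (@word_congM _ _ [:: i; j] [:: j; i]).
Qed.

Inductive contraction : seq S -> Prop :=
| contraction_sq i : contraction [:: i; i]
| contraction_braid i j : adj i j -> contraction [:: i; j; i].

Definition contraction_free s :=
  forall x c y, contraction c -> ~ s ~ x ++ c ++ y.

Lemma contraction_free_cong s t : s ~ t -> contraction_free s -> contraction_free t.
Proof. by move=> st fs x c y cc tc; apply: (fs x c y cc); exact: comm_cong_trans st tc. Qed.

Lemma contraction_free_catl s t : contraction_free (s ++ t) -> contraction_free s.
Proof.
move=> fst x c y cc sc; apply: (fst x c (y ++ t) cc).
by have := word_congM sc (comm_cong_refl t); rewrite -!catA.
Qed.

Lemma contraction_rev c : contraction c -> rev c = c.
Proof. by case. Qed.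

Lemma contraction_free_rev s : contraction_free s -> contraction_free (rev s).
Proof.
move=> fs x c y cc /comm_cong_rev; rewrite revK !rev_cat (contraction_rev cc) -catA.
exact: fs.
Qed.

(** A factor i i would shorten the reduced word.  A factor i j i could be
    replaced by j i j, which gives a reduced expression with a different number
    of letters i, whereas commutations only permute letters. *)
Lemma contraction_free_reduced (w : coxeter adj) s :
  fully_commutative w -> reduced_expr s w -> contraction_free s.
Proof.
move=> fcw [sw red_s] x c y cc sc.
have word_eq t t' : word_cong (coxeter_rel adj) t t' ->
    coxeter_word adj t = coxeter_word adj t'.
  by rewrite !coxeter_wordE => /coxeter_classP.
have cw : coxeter_word adj (x ++ c ++ y) = w.
  rewrite -sw; apply/esym/word_eq; move: sc.
  apply: (@comm_cong_ind (word_cong (coxeter_rel adj))) => {red_s sw} [t|t t' u|t t'].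
  - exact: rst_refl.
  - exact: rst_trans.
  case=> x' [y' [u [v [uv -> ->]]]]; apply: rst_step; exists x', y', u, v; split=> //.
  by case: uv => i j _; exact: coxeter_comm.
have szc := perm_size (comm_cong_perm sc).
case: cc => [i|i j ij] in sc cw szc *.
  have : coxeter_word adj (x ++ y) = w.
    rewrite -cw; apply/esym/word_eq; apply: word_congM; first exact: rst_refl.
    rewrite -[X in word_cong _ _ X]cat0s.
    by apply: word_congM; [apply/word_cong_step/coxeter_sq|exact: rst_refl].
  by move/red_s; rewrite szc !size_cat /=; lia.
have braided : coxeter_word adj (x ++ [:: j; i; j] ++ y) = w.
  rewrite -cw; apply/esym/word_eq; do 2 (apply: word_congM; try exact: rst_refl).
  by apply/word_cong_step/coxeter_braid.
have := fcw (x ++ [:: i; j; i] ++ y) (x ++ [:: j; i; j] ++ y).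
have red_t t : size t = size s -> coxeter_word adj t = w -> reduced_expr t w.
  by move=> szt tw; split=> // r /red_s; rewrite szt.
move/(_ (red_t _ (esym szc) cw)); have szb := szc; rewrite !size_cat in szb.
move/(_ (red_t _ _ braided)); rewrite szc !size_cat => /(_ erefl).
move/comm_cong_perm; rewrite perm_cat2l perm_cat2r => /permP/(_ (pred1 i)) /=.
have /negbTE -> : j != i by apply: contraTneq ij => ->; rewrite adj_irr.
by rewrite eqxx.
Qed.

Section Rigidity.
Variable N : seq S -> nat.

(** The argument is run for an abstract N because it is applied both to [loops]
    and to its composition with reversal, which exchanges the two cases of
    property P1. *)
Definition rigid s := N s = 1 /\ forall s', deletion s s' -> N s' = 1.

Hypotheses (N_cong : forall s t, s ~ t -> N s = N t)
  (N_braid : forall u i j v, adj i j ->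
     N (u ++ [:: i; j; i] ++ v) = N (u ++ [:: i] ++ v))
  (N_tail : forall u a b, adj a b -> N (u ++ [:: b; a]) = N (u ++ [:: b])).

(** The word u a may fail to be contraction free, but only by a contraction
    a j a that uses the new final a, as any other contraction would give one of
    u b a.  Contracting it leaves an omission of the shorter word u. *)
Lemma rigid_omit u a b : adj a b -> contraction_free (u ++ [:: b; a]) ->
    (forall t, size t <= (size u).+1 -> contraction_free t -> rigid t) ->
  N (u ++ [:: a]) = 1.
Proof.
move=> ab fuba IH.
have fu : contraction_free u by exact: contraction_free_catl fuba.
have uba t : u ~ t -> u ++ [:: b; a] ~ t ++ [:: b; a] by move=> ut; exact: word_congM.
have [/IH[]|] := pselect (contraction_free (u ++ [:: a])); rewrite ?size_cat ?addn1 //.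
move=> /existsNP[x /existsNP[c /existsNP[y /not_implyP[cc /contrapT uac]]]].
(* z is what remains of x c y when the final a of u a is taken out. *)
have [z + uz] := pulls_comm_cong uac (pulls_last a u).
case/pulls_cat => [[z' + Ez]|[x' [_ _ Ez]]]; last first.
  by case: (fu x' c y cc); rewrite -Ez.
case/pulls_cat => [[y' _ Ez']|[c' [cc' ya Ez']]].
  by case: (fu x c y' cc); rewrite -Ez' -Ez.
rewrite {z'}Ez' in Ez; rewrite {z}Ez in uz.
have moved t : t ++ y ++ [:: a] ~ t ++ [:: a] ++ y.
  by apply: word_congM => //; exact/comm_cong_sym/comm_cong_move.
case: cc => [i|i j ij] in uac cc' *.
  (* A square a a would turn u b a into a word with the factor a b a. *)
  case/pulls_consE: cc' => [[-> /= + _]|[d + Ec']]; first by rewrite /commutes_with eqxx.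
  case/pulls_consE => [[Ei _ Ed]|[d' /pulls_nil //]].
  rewrite Ec' Ed Ei in uz; case: (fuba (x ++ y) [:: a; b; a] [::]).
    exact: contraction_braid.
  apply: comm_cong_trans (uba _ uz) _; rewrite cats0 -!catA; apply: word_congM => //.
  rewrite catA -[y ++ [:: a; b; a]]/(y ++ [:: a] ++ [:: b; a]) [y ++ _]catA.
  apply: word_congM => //.
  exact: comm_cong_move.
(* In i j i, only the last letter can be a: the others do not commute with what
   follows them. *)
case/pulls_consE: cc' => [[Ei /= /andP[/andP[_ ja] _] _]|[d + Ec']].
  by rewrite adj_sym -Ei ij in ja.
case/pulls_consE => [[Ej /= /andP[/andP[_ ia] _] _]|[d' + Ed]].
  by rewrite -Ej ij in ia.
case/pulls_consE => [[Ei _ Ed']|[d'' /pulls_nil //]].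
rewrite Ec' Ed Ed' Ei in uz; rewrite Ei in ij.
have del_j : deletion (x ++ [:: a; j] ++ y) (x ++ [:: a] ++ y).
  exact/deletion_catr/deletion_cons/deletion_head.
have [u' uu' u'x] := deletion_comm_cong uz del_j.
have [_ /(_ _ uu')] := IH u (leqnSn _) fu; rewrite (N_cong u'x) => <-.
rewrite -(N_braid _ _ ij); apply: N_cong.
apply: (@comm_cong_trans ((x ++ [:: a; j] ++ y) ++ [:: a])); first exact: word_congM.
by rewrite -!catA catA [X in _ ~ X](catA x [:: a; j]); exact: moved.
Qed.

Lemma rigid_tail s u a b : adj a b -> contraction_free s -> s ~ u ++ [:: b; a] ->
    (forall t, size t < size s -> contraction_free t -> rigid t) ->
  rigid s.
Proof.
move=> ab fs suba IH; have fuba := contraction_free_cong suba fs.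
have szs : size s = (size u).+2.
  by rewrite (perm_size (comm_cong_perm suba)) size_cat addn2.
have [Nub Nub'] : rigid (u ++ [:: b]).
  apply: IH; first by rewrite szs size_cat addn1.
  by apply: (@contraction_free_catl _ [:: a]); rewrite -catA.
split=> [|s' ss']; first by rewrite (N_cong suba) N_tail.
have [t' ut' /N_cong <-] := deletion_comm_cong (comm_cong_sym suba) ss'.
case/deletion_cat: ut' => [[u' uu' ->]|[c + ->]].
  by rewrite N_tail //; apply/Nub'/deletion_catl.
case/(@deletion_cat [:: b]) => [[c' cc' ->]|[c' cc' ->]].
  rewrite (deletion_seq1 cc').
  by apply: (rigid_omit ab fuba) => t szt; apply: IH; rewrite szs ltnS.
by rewrite (deletion_seq1 cc') cats0.
Qed.

End Rigidity.

Lemma rigid_rev N s : rigid N (rev s) -> rigid (N \o rev) s.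
Proof. by case=> Ns Ndel; split=> // s' /deletion_rev; exact: Ndel. Qed.

Lemma loops_comm_cong s t : s ~ t -> loops adj s = loops adj t.
Proof.
move: s t; apply: (@comm_cong_ind (fun s t => loops adj s = loops adj t))
  => [//|s t u -> //|s t [x [y [u [v [uv -> ->]]]]]].
by case: uv => i j _ nij; exact: loops_swap.
Qed.

Lemma deletion_subseq s s' : deletion s s' -> subseq s' s.
Proof.
elim=> {s s'} [i s|i s s' _ IHs]; first exact: subseq_cons.
by rewrite /= eqxx.
Qed.

Definition end_reducible s := exists u a b, adj a b /\ s ~ u ++ [:: b; a].

Lemma contraction_free_rigid :
  (forall s, contraction_free s ->
     [\/ uniq s, end_reducible s | end_reducible (rev s)]) ->
  forall s, contraction_free s -> rigid (loops adj) s.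
Proof.
move=> regular_words s; have [n] := ubnP (size s); elim: n s => // n IHn s szs fs.
have IH t : size t < size s -> contraction_free t -> rigid (loops adj) t.
  by move=> ts; apply: IHn; apply: leq_trans ts _.
case: (regular_words s fs) => [us|[u [a [b [ab su]]]]|[u [a [b [ab su]]]]].
- split; first exact: loops_uniq.
  by move=> s' /deletion_subseq s's; apply/loops_uniq/(subseq_uniq s's).
- apply: (rigid_tail _ _ _ ab fs su IH); first exact: loops_comm_cong.
    by move=> x i j y; exact: loops_braid.
  by move=> x i j; exact: loops_tail.
have eq_rev : loops adj =1 (loops adj \o rev) \o rev by move=> t; rewrite /= revK.
have: rigid (loops adj \o rev) (rev s).
  apply: (rigid_tail _ _ _ ab (contraction_free_rev fs) su)
    => [t t' tt'|x i j y ij|x i j ij|t].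
  - exact/loops_comm_cong/comm_cong_rev.
  - by rewrite /comp !rev_cat -!catA; exact: loops_braid.
  - by rewrite /comp !rev_cat; exact: loops_head.
  rewrite size_rev => ts ft; apply: rigid_rev; apply: IH; first by rewrite size_rev.
  exact: contraction_free_rev.
case=> /=; rewrite revK => Ns Ndel; split=> // s' /deletion_rev/Ndel.
by rewrite revK.
Qed.

End CommutationClasses.

(** * Heaps of words *)

Section HeapCovers.
Variables (P : choiceType) (C : rel P) (Csym : symmetric C).
Implicit Types E F : lheap C.

Lemma hle_first_edge E (x y : E) : hlt x y ->
  exists2 r, r != x & [/\ hle x r, C (label x) (label r) & hle r y].
Proof.
case/andP => xy; rewrite hle_closure => /connectP[p0 xp0 Ey]; move: xy; rewrite Ey.
case/shortenP: xp0 => [[|r p]] /=; first by rewrite eqxx.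
case/andP => /andP[xr Cxr] rp /andP[xnp _] _ _; exists r.
  by apply: contraNneq xnp => ->; rewrite mem_head.
by split=> //; rewrite hle_closure; apply/connectP; exists p.
Qed.

Lemma hle_last_edge E (x y : E) : hlt x y ->
  exists2 r, r != y & [/\ hle r y, C (label r) (label y) & hle x r].
Proof.
case/andP => + xy; move: xy; rewrite hle_closure => /connectP[p0 xp0 ->].
case/shortenP: xp0 => p; case: (lastP p) => [|{}p r]; first by rewrite /= eqxx.
rewrite rcons_path last_rcons -rcons_cons rcons_uniq.
case/andP=> xp /andP[pr Cpr] /andP[up _] _ _; exists (last x p).
  by apply: contraNneq up => <-; exact: mem_last.
by split=> //; rewrite hle_closure; apply/connectP; exists p.
Qed.

Lemma covering_concurrent E (x y : E) :
  hlt x y -> (forall r, hlt x r -> ~~ hlt r y) -> C (label x) (label y).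
Proof.
move=> xy cover; have [r rx [xr Cxr ry]] := hle_first_edge xy.
suff /eqP <- : r == y by [].
by apply: contraNT (cover r _) => [ney|]; rewrite /hlt ?ney // eq_sym rx.
Qed.

Lemma property_P1_last_step E : property_P1 Csym E ->
  trivial_heap E \/ exists F, prec Csym F E.
Proof.
case=> E1 trE1 /clos_rt_rtn1_iff; case=> [|F G FG _]; first by left.
by right; exists F.
Qed.

(** Every edge going up from b must end at a, for otherwise it would survive in
    E(a) and b would not become maximal there. *)
Lemma prec_plusP E F : prec_plus Csym F E -> exists a b : E,
  [/\ maximal E a, b != a, hle b a, concurrency_graph C (label a) (label b) &
      forall r, r != a -> hle b r -> C (label b) (label r) -> r = b].
Proof.
case=> a [_ max_a [b [max_b lab nmax_b]]].
have ba : val b != a by move: (valP b); rewrite in_setC1.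
have only_a r : r != a -> hle (val b) r -> C (label (val b)) (label r) -> r = val b.
  move=> ra br Cbr; have rD : r \in [set~ a] by rewrite in_setC1.
  by rewrite -(max_b (Sub r rD) _) //; exact: sub_hle_edge.
have [c /not_implyP[bc /eqP cb]] : exists c, ~ (hle (val b) c -> c = val b).
  exact/existsNP.
have bc' : hlt (val b) c by rewrite /hlt eq_sym cb.
have [r rb [br Cbr _]] := hle_first_edge bc'.
have Er : r = a by apply: contra_neq_eq rb => ra; exact: only_a.
rewrite {r}Er in br Cbr rb; exists a, (val b); split=> //.
by rewrite /concurrency_graph Csym Cbr andbT eq_sym; apply/eqP.
Qed.

Lemma prec_minusP E F : prec_minus Csym F E -> exists a b : E,
  [/\ minimal E a, b != a, hle a b, concurrency_graph C (label a) (label b) &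
      forall r, r != a -> hle r b -> C (label r) (label b) -> r = b].
Proof.
case=> a [_ min_a [b [min_b lab nmin_b]]].
have ba : val b != a by move: (valP b); rewrite in_setC1.
have only_a r : r != a -> hle r (val b) -> C (label r) (label (val b)) -> r = val b.
  move=> ra br Cbr; have rD : r \in [set~ a] by rewrite in_setC1.
  by rewrite -(min_b (Sub r rD) _) //; exact: sub_hle_edge.
have [c /not_implyP[cb /eqP ncb]] : exists c, ~ (hle c (val b) -> c = val b).
  exact/existsNP.
have bc' : hlt c (val b) by rewrite /hlt ncb.
have [r rb [br Cbr _]] := hle_last_edge bc'.
have Er : r = a by apply: contra_neq_eq rb => ra; exact: only_a.
rewrite {r}Er in br Cbr rb; exists a, (val b); split=> //.
by rewrite /concurrency_graph Cbr andbT eq_sym; apply/eqP.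
Qed.

End HeapCovers.

Section WordHeap.
Variables (P : choiceType) (C : rel P).
Hypotheses (Csym : symmetric C) (Crefl : reflexive C).
Variable s : seq P.

Local Notation adj := (concurrency_graph C).
Local Notation "s ~ t" := (word_cong (comm_rel adj) s t) (at level 70).

(** Vertices are positions rather than letters, so that repeated letters give
    distinct vertices. *)
Definition letter (p : 'I_(size s)) : P := tnth (in_tuple s) p.
Definition letter_edge : rel 'I_(size s) :=
  fun p q => (p <= q) && C (letter p) (letter q).
Definition word_hle : rel 'I_(size s) := connect letter_edge.

Lemma word_hle_leq p q : word_hle p q -> p <= q.
Proof.
move=> /connectP[r]; elim: r p => [|x r IHr] p /=; first by move=> _ ->.
by case/andP=> /andP[px _] xr qr; exact: leq_trans px (IHr x xr qr).
Qed.

Lemma word_hle_anti : antisymmetric word_hle.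
Proof.
move=> p q /andP[/word_hle_leq pq /word_hle_leq qp].
by apply/val_inj/anti_leq; rewrite pq.
Qed.

Lemma word_hle_trans : transitive word_hle.
Proof. by move=> q p r; exact: connect_trans. Qed.

Lemma word_hle_comparable p q : C (letter p) (letter q) -> word_hle p q || word_hle q p.
Proof.
move=> Cpq; case/orP: (leq_total p q) => pq; apply/orP; [left|right];
  by apply: connect1; rewrite /letter_edge pq // Csym.
Qed.

Lemma word_hle_closure : word_hle =2 closureC C word_hle letter.
Proof.
move=> p q; apply/idP/idP; apply: connect_sub => {p q} p q.
  by move=> pq; apply: connect1; rewrite /word_hle connect1 //; case/andP: pq.
by case/andP.
Qed.

Definition word_heap : lheap C :=
  LHeap (@connect0 _ letter_edge) word_hle_anti word_hle_trans word_hle_comparable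
        word_hle_closure.

Local Notation ltn_ordered := (pairwise (fun p q : 'I_(size s) => p < q)).

Lemma enum_ltn_ordered : ltn_ordered (enum 'I_(size s)).
Proof.
have := iota_ltn_sorted 0 (size s).
by rewrite -val_enum_ord sorted_pairwise; [rewrite pairwise_map|exact: ltn_trans].
Qed.

Lemma filter_eq_ordered (F : seq 'I_(size s)) : ltn_ordered F ->
  [seq p <- enum 'I_(size s) | p \in F] = F.
Proof.
have ltT : transitive (fun p q : 'I_(size s) => p < q) by move=> ? ? ?; exact: ltn_trans.
have ltI : irreflexive (fun p q : 'I_(size s) => p < q) by move=> ?; exact: ltnn.
rewrite -(sorted_pairwise ltT) => sF.
apply: (irr_sorted_eq ltT ltI) => // [|p].
  by rewrite (sorted_pairwise ltT) pairwise_filter // enum_ltn_ordered.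
by rewrite mem_filter mem_enum andbT.
Qed.

Lemma map_letter_enum : map letter (enum 'I_(size s)) = s.
Proof. exact: (map_tnth_enum (in_tuple s)). Qed.

(** A set of positions closed under going down the edges can be moved to the
    front: whenever a position outside the set precedes one inside, there is no
    edge between them, so their letters commute. *)
Lemma lower_set_first (D : pred 'I_(size s)) (r : seq 'I_(size s)) :
    ltn_ordered r ->
    {in r &, forall p q, letter_edge p q -> D q -> D p} ->
  map letter r ~ map letter (filter D r) ++ map letter (filter (predC D) r).
Proof.
elim: r => [|p r IHr] /=; first by move=> _ _; exact: rst_refl.
case/andP=> /allP pr /IHr{}IHr lowD.
have {}IHr : map letter r ~ map letter (filter D r) ++ map letter (filter (predC D) r).
  by apply: IHr => x y xr yr; apply: lowD; rewrite inE ?xr ?yr orbT.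
have [Dp|nDp] /= := boolP (D p).
  exact: (@word_congM _ _ [:: letter p] [:: letter p] _ _ (comm_cong_refl _ _)).
set y := map letter (filter D r) in IHr *; set z := map letter (filter (predC D) r) in IHr *.
apply: (@comm_cong_trans _ _ (letter p :: y ++ z)).
  exact: (@word_congM _ _ [:: letter p] [:: letter p] _ _ (comm_cong_refl _ _)).
rewrite -[letter p :: z]/([:: letter p] ++ z) catA -cat_cons.
apply: word_congM; last exact: comm_cong_refl.
apply: comm_cong_move; first by move=> i j; rewrite /concurrency_graph eq_sym Csym.
apply/allP => _ /mapP[q + ->]; rewrite mem_filter => /andP[Dq qr].
have nC : ~~ C (letter p) (letter q).
  apply: contra nDp => Cpq; apply: (lowD p q _ _ _ Dq); rewrite ?mem_head ?inE ?qr ?orbT //.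
  by rewrite /letter_edge Cpq (ltnW (pr q qr)).
rewrite /commutes_with /concurrency_graph Csym (negbTE nC) andbF andbT.
by apply: contraNneq nC => ->.
Qed.

Lemma word_hlt_ltn p q : @hlt P C word_heap p q -> p < q.
Proof. by case/andP=> npq /word_hle_leq pq; rewrite ltn_neqAle pq andbT. Qed.

(** The positions below a convex chain, and these together with the chain, are
    both lower sets; moving them to the front makes the chain a factor. *)
Lemma convex_chain_factor (F : seq word_heap) : convex_chain F ->
  exists u v, s ~ u ++ map letter F ++ v.
Proof.
case=> sF convF.
have ordF : ltn_ordered F.
  rewrite -sorted_pairwise; last by move=> ? ? ?; exact: ltn_trans.
  by apply: sub_sorted sF => p q; exact: word_hlt_ltn.
pose below (p : 'I_(size s)) := (p \notin F) && has (word_hle p) F.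
pose upto (p : 'I_(size s)) := below p || (p \in F).
have low_below p q : letter_edge p q -> upto q -> upto p.
  move=> pq; have hpq : word_hle p q by exact: connect1.
  rewrite /upto /below; have [pF|pF] := boolP (p \in F); first by rewrite !orbT.
  rewrite orbF /= => /orP[/andP[_ /hasP[f fF qf]]|qF]; apply/hasP.
    by exists f => //; exact: connect_trans qf.
  by exists q.
have low_below' p q : letter_edge p q -> below q -> below p.
  move=> pq qb; have := low_below p q pq; rewrite /upto qb /= => /(_ isT)/orP[//|pF].
  have hpq : word_hle p q by exact: connect1.
  case/andP: qb => qF /hasP[f fF qf]; case/negP: (qF).
  apply: (convF p q f) => //; apply/andP; split=> //.
    by apply: contraNneq qF => <-.
  by apply: contraNneq qF => ->.
have {}low_below p q (_ : p \in enum 'I_(size s)) (_ : q \in enum 'I_(size s)) :=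
  low_below p q.
have s1 := lower_set_first enum_ltn_ordered low_below; rewrite map_letter_enum in s1.
have ord2 : ltn_ordered (filter upto (enum 'I_(size s))).
  by rewrite pairwise_filter // enum_ltn_ordered.
have s2 := lower_set_first ord2 (in2W low_below').
have EF : filter (predC below) (filter upto (enum 'I_(size s))) = F.
  rewrite -filter_predI -[RHS](filter_eq_ordered ordF); apply: eq_filter => p /=.
  by rewrite /upto /below; case: (p \in F) => //=; rewrite orbF andNb.
rewrite EF in s2; eexists; eexists; apply: comm_cong_trans s1 _; rewrite catA.
by apply: word_congM; [exact: s2|exact: comm_cong_refl].
Qed.

Lemma word_heap_P2 : contraction_free adj s -> property_P2 word_heap.
Proof.
move=> fs; split=> [x y z|x z] conv.
  have [u [v su]] := convex_chain_factor conv; move=> lxz.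
  case: conv => /= /and3P[xy yz _] conv.
  have Cxy : C (letter x) (letter y).
    apply: (@covering_concurrent _ _ word_heap _ _ xy) => r xr; apply/negP => ry.
    have := conv x r y; rewrite !inE !eqxx ?orbT => /(_ isT isT xr ry).
    case/or3P => /eqP Er.
    - by move: xr; rewrite Er /hlt eqxx.
    - by move: ry; rewrite Er /hlt eqxx.
    - have := word_hlt_ltn yz; have := word_hlt_ltn ry; rewrite Er; lia.
  have lxz' : letter x = letter z := lxz.
  rewrite /= -lxz' in su; have [xy'|xy'] := eqVneq (letter x) (letter y).
    apply: (fs u [:: letter x; letter x] (letter x :: v)); first exact: contraction_sq.
    by rewrite -xy' in su.
  apply: (fs u [:: letter x; letter y; letter x] v _ su); apply: contraction_braid.
  by rewrite /concurrency_graph xy'.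
have [u [v su]] := convex_chain_factor conv; move=> lxz.
have lxz' : letter x = letter z := lxz.
rewrite /= -lxz' in su; apply: (fs u [:: letter x; letter x] v _ su); exact: contraction_sq.
Qed.

(** The pair a, b of the last step of property P1 is an upper or a lower set, so
    it can be moved to the end or to the front of the word. *)
Lemma word_heap_P1 : property_P1 Csym word_heap ->
  [\/ uniq s, end_reducible adj s | end_reducible adj (rev s)].
Proof.
case/property_P1_last_step => [triv|[F [/prec_plusP|/prec_minusP] [a [b]]]].
- constructor 1; rewrite -map_letter_enum map_inj_uniq ?enum_uniq // => p q pq.
  have /word_hle_comparable : C (letter p) (letter q) by rewrite pq.
  by case/orP => [/(triv p q)|/(triv q p)].
- case=> max_a ba hba ab only_a; constructor 2.
  have ord : ltn_ordered [:: b; a].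
    by rewrite /= !andbT; apply: word_hlt_ltn; rewrite /hlt ba.
  pose D := [pred p | p \notin [:: b; a]].
  have lowD : {in enum 'I_(size s) &, forall p q,
      letter_edge p q -> D q -> D p}.
    move=> p q _ _ /[dup] pq /andP[_ Cpq]; have hpq : word_hle p q by exact: connect1.
    rewrite !inE; apply: contra => /orP[/eqP Ep|/eqP Ep].
      rewrite Ep in hpq Cpq; have [->|qa] := eqVneq q a; first by rewrite orbT.
      by rewrite (only_a q qa hpq Cpq) eqxx.
    by rewrite Ep in hpq; rewrite (max_a q hpq) eqxx orbT.
  have := lower_set_first enum_ltn_ordered lowD; rewrite map_letter_enum.
  rewrite [X in _ ++ map _ X](eq_filter (a2 := mem [:: b; a])); last first.
    by move=> p /=; rewrite negbK.
  rewrite filter_eq_ordered // => su.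
  exists (map letter (filter D (enum 'I_(size s)))), (letter a), (letter b).
  by split.
- case=> min_a ba hba ab only_a; constructor 3.
  have ord : ltn_ordered [:: a; b].
    by rewrite /= !andbT; apply: word_hlt_ltn; rewrite /hlt eq_sym ba.
  pose D := [pred p | p \in [:: a; b]].
  have lowD : {in enum 'I_(size s) &, forall p q,
      letter_edge p q -> D q -> D p}.
    move=> p q _ _ /[dup] pq /andP[_ Cpq]; have hpq : word_hle p q by exact: connect1.
    rewrite /D /= !inE => /orP[/eqP Eq|/eqP Eq].
      by rewrite Eq in hpq; rewrite (min_a p hpq) eqxx.
    rewrite Eq in hpq Cpq; have [//|pa] := eqVneq p a.
    by rewrite (only_a p pa hpq Cpq) eqxx orbT.
  have := lower_set_first enum_ltn_ordered lowD; rewrite map_letter_enum.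
  rewrite filter_eq_ordered // => su.
  exists (rev (map letter (filter (predC D) (enum 'I_(size s))))), (letter a), (letter b).
  split=> //.
  rewrite (_ : [:: letter b; letter a] = rev (map letter [:: a; b])) // -rev_cat.
  apply: comm_cong_rev su; by move=> i j; rewrite /concurrency_graph eq_sym Csym.
Qed.

End WordHeap.

(** * The exponent of an omission *)

Local Open Scope ring_scope.

Theorem proposition3p4p2 (P : choiceType) (C : rel P)
    (Csym : symmetric C) (Crefl : reflexive C) (Creg : regular Csym)
    (e : seq P) (w : coxeter (concurrency_graph C)) (m : nat)
    (w_fc : fully_commutative w)
    (def_e : tl_word (concurrency_graph C) e = delta ^+ m *: tl_basis w)
    (l : nat) (l_lt : (l < size e)%N)
    (w' : coxeter (concurrency_graph C)) (m' : nat)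
    (w'_fc : fully_commutative w')
    (def_e' : tl_word (concurrency_graph C) (take l e ++ drop l.+1 e) =
              delta ^+ m' *: tl_basis w') :
  (m'%:Z \in [:: m%:Z - 1; m%:Z; m%:Z + 1]) /\
  ((exists x : coxeter (concurrency_graph C),
      fully_commutative x /\ reduced_expr e x) -> m' = 0%N).
Proof.
set adj := concurrency_graph C in w m w_fc def_e w' m' w'_fc def_e' *.
have adj_irr : irreflexive adj by move=> i; rewrite /adj /concurrency_graph eqxx.
have adj_sym : symmetric adj.
  by move=> i j; rewrite /adj /concurrency_graph eq_sym Csym.
have rigid_words s : contraction_free adj s -> rigid (loops adj) s.
  apply: (contraction_free_rigid adj_irr adj_sym) => {}s fs.
  exact/(word_heap_P1 Crefl)/Creg/word_heap_P2.
have loops_fc x k s : fully_commutative x ->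
    tl_word adj s = delta ^+ k *: tl_basis x -> loops adj s = (2 ^ k)%N.
  move=> x_fc /(loops_tl_word adj_irr adj_sym) ->.
  have [-> _] := rigid_words _
    (contraction_free_reduced adj_irr adj_sym x_fc (reduced_wordP x)).
  exact: muln1.
have loops_e := loops_fc _ _ _ w_fc def_e.
have loops_e' := loops_fc _ _ _ w'_fc def_e'.
have pow_leq a b : (2 ^ a <= 2 * 2 ^ b)%N -> (a <= b.+1)%N.
  by rewrite -expnS leq_exp2l.
split.
  have x0 : P by case: e l_lt {def_e def_e' loops_e loops_e'} => // x0.
  have Ee : take l e ++ nth x0 e l :: drop l.+1 e = e by rewrite -drop_nth // cat_take_drop.
  have := loops_delete_leq adj (nth x0 e l) (take l e) (drop l.+1 e).
  have := loops_insert_leq adj (nth x0 e l) (take l e) (drop l.+1 e).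
  rewrite Ee loops_e loops_e' => /pow_leq mm' /pow_leq m'm; rewrite !inE; lia.
case=> x [x_fc red_e].
have [_ /(_ _ (deletion_take_drop l_lt))] :=
  rigid_words _ (contraction_free_reduced adj_irr adj_sym x_fc red_e).
by rewrite loops_e' => /eqP; rewrite -[X in _ == X](expn0 2) eqn_exp2l // => /eqP.
Qed.
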